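(* Let $n\ge 1$ and let $A\in\mathcal{M}_n(\mathbb{R})$. Then the Bild of $A$ coincides with the complex numerical range of $A$, that is, $W_{\mathbb{H}}(A)\cap\mathbb{C}=W_{\mathbb{C}}(A)$.
   Context: $\mathbb{H}$ denotes the real quaternions with basis $1,i,j,k$ (with $i^2=j^2=k^2=ijk=-1$), and $\mathbb{R}\subset\mathbb{C}=\mathrm{span}_{\mathbb{R}}\{1,i\}\subset\mathbb{H}$. For $q\in\mathbb{H}$, $q^*$ is the quaternionic conjugate and $|q|^2=qq^*$. For $\mathbb{F}\in\{\mathbb{R},\mathbb{C},\mathbb{H}\}$, $\mathcal{M}_n(\mathbb{F})$ is the set of $n\times n$ matrices over $\mathbb{F}$, and the numerical range of $A\in\mathcal{M}_n(\mathbb{F})$ in $\mathbb{F}$ is $W_{\mathbb{F}}(A)=\{x^*Ax : x\in\mathbb{F}^n,\ |x|=1\}$, where $x$ is a column vector, $x^*$ its conjugate transpose, and $|x|^2=\sum_l |x_l|^2$. A real matrix is also regarded as a complex and as a quaternionic matrix via $\mathbb{R}\subset\mathbb{C}\subset\mathbb{H}$. The Bild of $A$ is $B(A)=W_{\mathbb{H}}(A)\cap\mathbb{C}$. *)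

(* Defs.v *)
From HB Require Import structures.
From mathcomp Require Import all_boot all_order all_algebra.
From mathcomp Require Import ring.
From mathcomp Require Import complex.
From mathcomp Require Import boolp classical_sets reals.

Set Implicit Arguments.
Unset Strict Implicit.
Unset Printing Implicit Defensive.
Import Order.TTheory GRing.Theory Num.Theory.
Local Open Scope ring_scope.
Local Open Scope classical_set_scope.

(* [Quat a b c d] is a + b i + c j + d k. *)
Record quat (R : Type) : Type := Quat { qr : R; qi : R; qj : R; qk : R }.

Section QuatChoice.
Variable R : Type.

Definition tuple_of_quat (q : quat R) : R * R * R * R :=
  (qr q, qi q, qj q, qk q).
Definition quat_of_tuple (t : R * R * R * R) : quat R :=
  let: (a, b, c, d) := t in Quat a b c d.

Lemma tuple_of_quatK : cancel tuple_of_quat quat_of_tuple.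
Proof. by case. Qed.

End QuatChoice.

HB.instance Definition _ (R : choiceType) :=
  Choice.copy (quat R) (can_type (@tuple_of_quatK R)).

Section QuatRing.
Variable R : comNzRingType.
Implicit Types p q r : quat R.

Definition addh p q :=
  Quat (qr p + qr q) (qi p + qi q) (qj p + qj q) (qk p + qk q).
Definition opph p := Quat (- qr p) (- qi p) (- qj p) (- qk p).
Definition zeroh : quat R := Quat 0 0 0 0.
Definition oneh : quat R := Quat 1 0 0 0.
Definition mulh p q :=
  Quat (qr p * qr q - qi p * qi q - qj p * qj q - qk p * qk q)
       (qr p * qi q + qi p * qr q + qj p * qk q - qk p * qj q)
       (qr p * qj q - qi p * qk q + qj p * qr q + qk p * qi q)
       (qr p * qk q + qi p * qj q - qj p * qi q + qk p * qr q).

Fact addhA : associative addh.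
Proof. by move=> p q r; rewrite /addh /= !addrA. Qed.
Fact addhC : commutative addh.
Proof. by move=> p q; congr Quat; exact: addrC. Qed.
Fact add0h : left_id zeroh addh.
Proof. by case=> a b c d; congr Quat; exact: add0r. Qed.
Fact addNh : left_inverse zeroh opph addh.
Proof. by move=> p; congr Quat; exact: addNr. Qed.

HB.instance Definition _ :=
  GRing.isZmodule.Build (quat R) addhA addhC add0h addNh.

Fact mulhA : associative mulh.
Proof. by move=> p q r; congr Quat => /=; ring. Qed.
Fact mul1h : left_id oneh mulh.
Proof. by case=> a b c d; congr Quat => /=; ring. Qed.
Fact mulh1 : right_id oneh mulh.
Proof. by case=> a b c d; congr Quat => /=; ring. Qed.
Fact mulhDl : left_distributive mulh addh.
Proof. by move=> p q r; congr Quat => /=; ring. Qed.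
Fact mulhDr : right_distributive mulh addh.
Proof. by move=> p q r; congr Quat => /=; ring. Qed.
Fact oneh_neq0 : oneh != 0 :> quat R.
Proof. by apply/eqP=> -[/eqP]; rewrite oner_eq0. Qed.

HB.instance Definition _ :=
  GRing.Zmodule_isNzRing.Build (quat R) mulhA mul1h mulh1 mulhDl mulhDr
    oneh_neq0.

Definition conjh q := Quat (qr q) (- qi q) (- qj q) (- qk q).

Definition quat_of_complex (z : R[i]) : quat R := Quat (complex.Re z) (complex.Im z) 0 0.
Definition quat_of_real (a : R) : quat R := quat_of_complex (real_complex R a).

Definition quat_i : quat R := Quat 0 1 0 0.
Definition quat_j : quat R := Quat 0 0 1 0.
Definition quat_k : quat R := Quat 0 0 0 1.

Lemma quat_i2 : quat_i * quat_i = -1.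
Proof. by congr Quat => /=; ring. Qed.
Lemma quat_j2 : quat_j * quat_j = -1.
Proof. by congr Quat => /=; ring. Qed.
Lemma quat_k2 : quat_k * quat_k = -1.
Proof. by congr Quat => /=; ring. Qed.
Lemma quat_ijk : quat_i * quat_j * quat_k = -1.
Proof. by congr Quat => /=; ring. Qed.

Lemma quatE q :
  q = quat_of_real (qr q) + quat_of_real (qi q) * quat_i
      + quat_of_real (qj q) * quat_j + quat_of_real (qk q) * quat_k.
Proof. by case: q => a b c d; congr Quat => /=; ring. Qed.

End QuatRing.

Section QuatOfComplex.
Variable R : realFieldType.

Fact quat_of_complex_is_zmod_morphism : zmod_morphism (@quat_of_complex R).
Proof. by move=> [a b] [c d]; congr Quat; rewrite /= ?oppr0 ?addr0. Qed.
Fact quat_of_complex_is_monoid_morphism :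
  monoid_morphism (@quat_of_complex R).
Proof. by split=> // -[a b] [c d]; congr Quat => /=; ring. Qed.

HB.instance Definition _ :=
  GRing.isZmodMorphism.Build R[i] (quat R) (@quat_of_complex R)
    quat_of_complex_is_zmod_morphism.
HB.instance Definition _ :=
  GRing.isMonoidMorphism.Build R[i] (quat R) (@quat_of_complex R)
    quat_of_complex_is_monoid_morphism.

Lemma quat_of_complex_inj : injective (@quat_of_complex R).
Proof. by move=> [a b] [c d] [-> ->]. Qed.

End QuatOfComplex.

Definition normh (R : rcfType) (q : quat R) : R :=
  Num.sqrt (qr q ^+ 2 + qi q ^+ 2 + qj q ^+ 2 + qk q ^+ 2).

Lemma sqr_normh (R : rcfType) (q : quat R) :
  quat_of_real (normh q ^+ 2) = q * conjh q.
Proof.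
rewrite sqr_sqrtr ?addr_ge0 ?sqr_ge0//.
by case: q => a b c d; congr Quat => /=; ring.
Qed.

(* [conj] and [nrm] are the conjugation and the modulus of F. *)
Section NumericalRange.
Variables (R : rcfType) (F : nzRingType) (conj : F -> F) (nrm : F -> R).

Definition vnorm n (x : 'cV[F]_n) : R :=
  Num.sqrt (\sum_(l < n) nrm (x l 0) ^+ 2).

Definition ctranspose n (x : 'cV[F]_n) : 'rV[F]_n := map_mx conj x^T.

Definition num_range n (A : 'M[F]_n) : set F :=
  [set (ctranspose x *m A *m x) 0 0 | x in [set x : 'cV[F]_n | vnorm x = 1]].

End NumericalRange.

Definition num_rangeC (R : rcfType) n (A : 'M[R[i]]_n) : set R[i] :=
  num_range (@conjc R) (@Normc.normc R) A.

Definition num_rangeH (R : rcfType) n (A : 'M[quat R]_n) : set (quat R) :=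
  num_range (@conjh R) (@normh R) A.

Definition bild (R : rcfType) n (A : 'M[quat R]_n) : set (quat R) :=
  num_rangeH A `&` range (@quat_of_complex R).

(* Main.v *)
(** Writing a quaternionic vector as x = u + v j with u, v complex, the complex
    part of x^* A x is u^* A u + w^* A w with w the conjugate of v, because A is
    real; since |u|^2 + |w|^2 = 1 this is a convex combination of two points of
    W_C(A), so it lies in W_C(A) by the Toeplitz-Hausdorff theorem.

    The latter reduces to finding an isotropic vector: if
    u^* M u + w^* M w = 0 then some nonzero z = s u + e w, with s real and e
    complex, satisfies z^* M z = 0; take M = A - lambda. *)
Require Import Defs.
From mathcomp Require Import all_boot all_order all_algebra.
From mathcomp Require Import ring.
From mathcomp Require Import complex.
From mathcomp Require Import classical_sets reals.
Import Order.TTheory GRing.Theory Num.Theory.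
Local Open Scope ring_scope.
Local Open Scope classical_set_scope.
Local Open Scope complex_scope.

(** * Complex quadratic forms and the Toeplitz-Hausdorff theorem *)

Section Sesquilinear.
Set Implicit Arguments.
Unset Strict Implicit.
Variables (R : rcfType) (n : nat).
Implicit Types (A M : 'M[R[i]]_n) (x y u w z : 'cV[R[i]]_n).

Definition sesq A x y : R[i] := (ctranspose (@conjc R) x *m A *m y) 0 0.

Definition sqnorm x : R := \sum_l Normc.normc (x l 0) ^+ 2.

Lemma sesqE A x y : sesq A x y = \sum_j \sum_i (x i 0)^*%C * A i j * y j 0.
Proof.
rewrite /sesq mxE; apply: eq_bigr => j _.
by rewrite mxE mulr_suml; apply: eq_bigr => i _; rewrite !mxE.
Qed.

Lemma sesqDl A x y z : sesq A (x + y) z = sesq A x z + sesq A y z.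
Proof.
by rewrite /sesq /ctranspose linearD /= map_mxD !mulmxDl mxE.
Qed.

Lemma sesqDr A x y z : sesq A x (y + z) = sesq A x y + sesq A x z.
Proof. by rewrite /sesq mulmxDr mxE. Qed.

Lemma sesqZl A a x y : sesq A (a *: x) y = a^*%C * sesq A x y.
Proof.
by rewrite /sesq /ctranspose linearZ /= map_mxZ -!scalemxAl mxE.
Qed.

Lemma sesqZr A a x y : sesq A x (a *: y) = a * sesq A x y.
Proof. by rewrite /sesq -scalemxAr mxE. Qed.

Lemma normc_sqr (a : R[i]) : (Normc.normc a ^+ 2)%:C = a^*%C * a.
Proof.
case: a => a b; rewrite /= sqr_sqrtr ?addr_ge0 ?sqr_ge0 //.
by apply/eqP; rewrite eq_complex /=; apply/andP; split; apply/eqP; ring.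
Qed.

Lemma sesq1 x : sesq 1%:M x x = (sqnorm x)%:C.
Proof.
rewrite /sesq mulmx1 mxE rmorph_sum; apply: eq_bigr => l _.
by rewrite !mxE -normc_sqr.
Qed.

Lemma sesq_subscalar A c x :
  sesq (A - c%:M) x x = sesq A x x - c * (sqnorm x)%:C.
Proof.
rewrite -sesq1 /sesq mulmxBr mulmxBl [LHS]mxE [X in _ + X]mxE; congr (_ - _).
by rewrite -[in LHS](scalemx1 _ c) -scalemxAr -scalemxAl mxE.
Qed.

Lemma sqnorm_ge0 x : 0 <= sqnorm x.
Proof. by apply: sumr_ge0 => l _; exact: sqr_ge0. Qed.

Lemma sqnorm_eq0 x : (sqnorm x == 0) = (x == 0).
Proof.
apply/idP/eqP => [|->]; last first.
  by rewrite /sqnorm big1 // => l _; rewrite mxE /= !expr0n /= addr0 sqrtr0 expr0n.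
rewrite psumr_eq0 => [/allP x0|l _]; last exact: sqr_ge0.
apply/colP => l; rewrite mxE; apply: Normc.eq0_normc; apply/eqP.
by have := x0 l (mem_index_enum l); rewrite sqrf_eq0.
Qed.

(* Im ((e c + conj e d) conj alpha) = 0 is one real linear equation in the two
   real coordinates of e. *)
Lemma exists_aligned_phase (al c d : R[i]) : al != 0 ->
  exists e : R[i], exists r : R,
    e != 0 /\ e * c + e^*%C * d = r%:C * al.
Proof.
move=> al0.
have imD (p q : R[i]) : complex.Im (p + q) = complex.Im p + complex.Im q.
  by case: p q => [? ?] [].
(* For e = x + iy, the imaginary part of (e c + conj e d) / al is x P + y Q; once it vanishes, the
   quotient is the real number r. *)
pose P := complex.Im ((c + d) / al); pose Q := complex.Im ('i * (c - d) / al).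
have key (x y : R) : x * P + y * Q = 0 ->
    exists r : R, (x +i* y) * c + (x +i* y)^*%C * d = r%:C * al.
  move=> xy0; exists (complex.Re (((x +i* y) * c + (x +i* y)^*%C * d) / al)).
  set t := _ / al.
  have -> : (complex.Re t)%:C = t.
    apply/eqP; rewrite eq_complex /= eqxx /= eq_sym; apply/eqP; rewrite -xy0.
    have -> : t = x%:C * ((c + d) / al) + y%:C * ('i * (c - d) / al).
      rewrite /t !mulrA -mulrDl; congr (_ / _).
      case: (c) (d) => [c1 c2] [d1 d2].
      by apply/eqP; rewrite eq_complex /=; apply/andP; split; apply/eqP; ring.
    rewrite imD /P /Q; case: (_ / al) => p1 p2; case: (_ / al) => q1 q2 /=.
    by ring.
  by rewrite divfK.
(* If P = Q = 0, then e = 1 works; otherwise (Q, -P) is a nonzero solution. *)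
have [/andP[/eqP P0 /eqP Q0]|PQ] := boolP ((P == 0) && (Q == 0)).
  have [|r er] := key 1 0; first by rewrite P0 Q0 !mulr0 addr0.
  by exists (1 +i* 0), r; split; rewrite // eq_complex /= oner_eq0.
have [|r er] := key Q (- P); first by ring.
exists (Q +i* - P), r; split=> //.
by rewrite eq_complex /= oppr_eq0 andbC.
Qed.

(** With al = u^* M u nonzero, r and e from [exists_aligned_phase] and m = |e|^2, the form at s u +
    e w equals (s^2 + r s - m) al, so a real root s suffices. *)
Lemma exists_isotropic M u w :
    (u != 0) || (w != 0) -> sesq M u u + sesq M w w = 0 ->
  exists2 z, z != 0 & sesq M z z = 0.
Proof.
move=> uw0 Muw.
have [Mu0|al0] := eqVneq (sesq M u u) 0.
  have [u0|] := eqVneq u 0; last by exists u.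
  exists w; first by move: uw0; rewrite u0 eqxx.
  by move: Muw; rewrite Mu0 add0r.
have [e [r [e0 er]]] := exists_aligned_phase (sesq M u w) (sesq M w u) al0.
pose m := Normc.normc e ^+ 2.
have m0 : 0 < m.
  rewrite lt_def sqr_ge0 andbT sqrf_eq0; apply: contra_neq e0.
  exact: Normc.eq0_normc.
(* A root of s^2 + r s - m; its discriminant is nonnegative since m > 0. *)
pose s := (- r + Num.sqrt (r ^+ 2 + 4 * m)) / 2.
have sE : s ^+ 2 + r * s - m = 0.
  have /sqr_sqrtr : 0 <= r ^+ 2 + 4 * m.
    by rewrite addr_ge0 ?sqr_ge0 // mulr_ge0 // ltW.
  rewrite /s; set q := Num.sqrt _ => qE.
  have -> : m = (q ^+ 2 - r ^+ 2) / 4 by rewrite qE; field.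
  by field.
have Mw : sesq M w w = - sesq M u u by apply/eqP; rewrite -addr_eq0 addrC Muw.
have cs : (s%:C)^*%C = s%:C by rewrite /= oppr0.
exists (s%:C *: u + e *: w).
  (* If s u = - e w, the form agrees at s u and e w: s^2 al = - m al. Then al = 0, because s^2 + m >
     0. *)
  apply: contra_neq al0 => /eqP; rewrite addr_eq0 => /eqP suew.
  have : sesq M (s%:C *: u) (s%:C *: u) = sesq M (e *: w) (e *: w).
    have cN1 : (-1 : R[i])^*%C = -1 by exact: rmorphN1.
    by rewrite suew -scaleN1r (sesqZl _ (-1)) (sesqZr _ (-1)) cN1 mulrA mulrNN !mul1r.
  rewrite !(sesqZl, sesqZr) cs !mulrA -normc_sqr -/m Mw mulrN => /eqP.
  rewrite -addr_eq0 -mulrDl -rmorphM -rmorphD mulf_eq0 => /orP[|/eqP //].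
  rewrite fmorph_eq0 => /eqP sm.
  by have := ltr_wpDl (sqr_ge0 s) m0; rewrite expr2 sm ltxx.
rewrite !(sesqDl, sesqDr, sesqZl, sesqZr) cs Mw.
transitivity ((s%:C ^+ 2 - e^*%C * e) * sesq M u u
              + s%:C * (e * sesq M u w + e^*%C * sesq M w u)); first by ring.
rewrite er -normc_sqr -/m mulrA -mulrDl.
by rewrite -rmorphXn -rmorphB -rmorphM -rmorphD addrAC [s * r]mulrC sE mul0r.
Qed.

(* The vectors u and w carry their convex weights |u|^2 and |w|^2. *)
Theorem toeplitz_hausdorff A u w : sqnorm u + sqnorm w = 1 ->
  exists2 z, sqnorm z = 1 & sesq A z z = sesq A u u + sesq A w w.
Proof.
move=> uw1; set la := sesq A u u + sesq A w w.
have uw0 : (u != 0) || (w != 0).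
  rewrite -negb_and -!sqnorm_eq0; apply/andP=> -[/eqP u0 /eqP w0].
  by move/eqP: uw1; rewrite u0 w0 addr0 eq_sym oner_eq0.
have [|z z0 Mz] := exists_isotropic (M := A - la%:M) uw0.
  rewrite !sesq_subscalar addrACA -opprD -mulrDr -rmorphD uw1 rmorph1.
  by rewrite mulr1 subrr.
have N0 : 0 < sqnorm z by rewrite lt_def sqnorm_eq0 z0 sqnorm_ge0.
(* Scaling by k makes the isotropic vector z of A - la a unit vector, where A takes the value la. *)
pose k := (Num.sqrt (sqnorm z))^-1.
have k2 : k * k * sqnorm z = 1.
  by rewrite -expr2 exprVn sqr_sqrtr ?sqnorm_ge0 // mulVf ?gt_eqF.
have Zk B : sesq B (k%:C *: z) (k%:C *: z) = (k * k)%:C * sesq B z z.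
  by rewrite sesqZl sesqZr /= oppr0 mulrA rmorphM.
exists (k%:C *: z).
  by apply: (fmorph_inj (real_complex R)); rewrite /= -sesq1 Zk sesq1 -rmorphM k2.
have {}Mz : sesq A z z = la * (sqnorm z)%:C.
  by apply/eqP; rewrite -subr_eq0 -sesq_subscalar Mz.
by rewrite Zk Mz mulrCA -rmorphM k2 mulr1.
Qed.

End Sesquilinear.

(** * Quaternionic vectors as pairs of complex vectors *)

Section BildReal.
Set Implicit Arguments.
Unset Strict Implicit.
Variables (R : rcfType) (n : nat).
Implicit Types (A : 'M[R]_n) (q : quat R) (x : 'cV[quat R]_n).

(* q = cpart q + conj (jpart q) j. *)
Definition cpart q : R[i] := qr q +i* qi q.
Definition jpart q : R[i] := qj q -i* qk q.

Lemma cpart_sum (I : Type) (s : seq I) (F : I -> quat R) :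
  cpart (\sum_(l <- s) F l) = \sum_(l <- s) cpart (F l).
Proof. by apply: (big_morph cpart) => // -[? ? ? ?] []. Qed.

(** The real a commutes with j, and the cross terms lie in C j, so they drop out of the complex
    part. *)
Lemma cpart_conj_real_mul (p q : quat R) (a : R) :
  cpart (conjh p * quat_of_real a * q)
  = (cpart p)^*%C * a%:C * cpart q + (jpart p)^*%C * a%:C * jpart q.
Proof.
case: p q => [p1 p2 p3 p4] [q1 q2 q3 q4].
by apply/eqP; rewrite eq_complex /=; apply/andP; split; apply/eqP; ring.
Qed.

Lemma normh_sqr q :
  normh q ^+ 2 = Normc.normc (cpart q) ^+ 2 + Normc.normc (jpart q) ^+ 2.
Proof.
by rewrite /normh !sqr_sqrtr ?addr_ge0 ?sqr_ge0 // sqrrN !addrA.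
Qed.

Lemma cpart_quadratic_form A x :
  cpart ((ctranspose (@conjh R) x *m map_mx (@quat_of_real R) A *m x) 0 0)
  = sesq (map_mx (real_complex R) A) (map_mx cpart x) (map_mx cpart x)
    + sesq (map_mx (real_complex R) A) (map_mx jpart x) (map_mx jpart x).
Proof.
rewrite !sesqE mxE cpart_sum -big_split /=; apply: eq_bigr => j _.
rewrite mxE mulr_suml cpart_sum -big_split /=; apply: eq_bigr => i _.
by rewrite !mxE cpart_conj_real_mul.
Qed.

(** [Num.sqrt] is 0 on negative numbers, so the value 1 forces a > 0. *)
Lemma sqrt_eq1 (a : R) : Num.sqrt a = 1 -> a = 1.
Proof.
move=> a1; have a0 : 0 <= a.
  by rewrite ltW // -sqrtr_gt0 a1.
by rewrite -[a]sqr_sqrtr // a1 expr1n.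
Qed.

Lemma bild_real_matrix A :
  bild (map_mx (@quat_of_real R) A)
  = @quat_of_complex R @` num_rangeC (map_mx (real_complex R) A).
Proof.
rewrite eqEsubset; split=> [_ [[x /sqrt_eq1 x1 <-]] [z _ zE]|_ [_ [x x1 <-] <-]].
  have uw1 : sqnorm (map_mx cpart x) + sqnorm (map_mx jpart x) = 1.
    rewrite -x1 /sqnorm -big_split /=; apply: eq_bigr => l _.
    by rewrite !mxE normh_sqr.
  have [y y1 yE] := toeplitz_hausdorff (map_mx (real_complex R) A) uw1.
  exists z => //; exists y; first by rewrite /= /vnorm -/(sqnorm y) y1 sqrtr1.
  (* By [zE] the quaternionic value is the complex number z, hence equal to its own [cpart]. *)
  by rewrite -/(sesq _ _ _) yE -cpart_quadratic_form -zE; case: (z).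
(* Conversely, a complex unit vector is a quaternionic unit vector giving the same value. *)
split; last by eexists.
exists (map_mx (@quat_of_complex R) x).
  rewrite -x1 /= /vnorm; congr Num.sqrt; apply: eq_bigr => l _.
  rewrite mxE normh_sqr /= !oppr0 !expr0n /= addr0 sqrtr0 expr0n addr0.
  by case: (x l 0).
rewrite -[RHS]/(quat_of_complex (sesq _ _ _)) sesqE mxE rmorph_sum.
apply: eq_bigr => j _.
rewrite mxE mulr_suml rmorph_sum; apply: eq_bigr => i _.
rewrite !mxE !rmorphM; congr (_ * _ * _).
by case: (x i 0) => a b; congr Quat; rewrite /= oppr0.
Qed.

End BildReal.

Theorem mainTheorem4 (R : realType) (n : nat) (n_gt0 : (0 < n)%N)
    (A : 'M[R]_n) :
  bild (map_mx (@quat_of_real R) A)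
  = @quat_of_complex R @` num_rangeC (map_mx (real_complex R) A).
Proof. exact: bild_real_matrix. Qed.
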